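(* Let $E_0\subset\mathbb{R}^2$ be an ellipse which is not a circle, let $(x_0,y_0)$ be the center of $E_0$, let $a$ and $b$ be the lengths of the semi-major and semi-minor axes of $E_0$, respectively, and let $F_2=(x_c,y_c)$ be the rightmost focus of $E_0$ (the uppermost focus if the major axis of $E_0$ is parallel to the $y$ axis). Suppose that the equation of $E_0$ is written in the form $$A(x-x_0)^2+B(x-x_0)(y-y_0)+C(y-y_0)^2-a^2b^2=0,$$ where $A,C>0$, and let $r=\sqrt{(A-C)^2+B^2}$. Then, if $B\neq 0$, $$x_c=x_0+\sqrt{\frac{r+C-A}{2}},\qquad y_c=y_0-(\operatorname{sgn}B)\sqrt{\frac{r+A-C}{2}},$$ and, if $B=0$, $$x_c=x_0+\frac12\bigl(1-\operatorname{sgn}(A-C)\bigr)\sqrt{\frac{r+C-A}{2}},\qquad y_c=y_0+\frac12\bigl(1+\operatorname{sgn}(A-C)\bigr)\sqrt{\frac{r+A-C}{2}}.$$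
   Context: $\operatorname{sgn}$ denotes the sign function ($\operatorname{sgn}t=1$ for $t>0$, $-1$ for $t<0$, $0$ for $t=0$). The coefficients $A,B,C$ are real. Saying that an equation is the equation of $E_0$ means that $E_0$ is exactly the set of points $(x,y)\in\mathbb{R}^2$ satisfying it. The ''rightmost focus'' is the focus with the larger $x$-coordinate; when the two foci have the same $x$-coordinate (major axis parallel to the $y$ axis), $F_2$ denotes instead the focus with the larger $y$-coordinate. *)

(* Defs.v *)
From Stdlib Require Import Reals.
From Coquelicot Require Import Coquelicot.
Open Scope R_scope.

Definition point : Type := (R * R)%type.

Definition edist (P Q : point) : R := dist_euc (fst P) (snd P) (fst Q) (snd Q).

Definition midpt (P Q : point) : point :=
  ((fst P + fst Q) / 2, (snd P + snd Q) / 2).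

Definition is_circle (E : point -> Prop) : Prop :=
  exists (O : point) (rho : R),
    0 < rho /\ forall P : point, E P <-> edist P O = rho.

(* E is an ellipse and F, G are its two foci. The strict inequality excludes
   segments and the empty set; F = G is allowed and gives the circles. *)
Definition ellipse_with_foci (E : point -> Prop) (F G : point) : Prop :=
  exists s : R,
    edist F G < s /\ forall P : point, E P <-> edist P F + edist P G = s.

Definition parallel_to (P Q F G : point) : Prop :=
  (fst Q - fst P) * (snd G - snd F) = (snd Q - snd P) * (fst G - fst F).

Definition orthogonal_to (P Q F G : point) : Prop :=
  (fst Q - fst P) * (fst G - fst F) + (snd Q - snd P) * (snd G - snd F) = 0.

(* The major axis is the chord of E on the line through the foci, the minor
   axis the chord through the center orthogonal to it; a semi-axis joins the
   center to an endpoint of the axis. By symmetry both endpoints give the same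
   length. *)
Definition semi_major_axis (E : point -> Prop) (F G : point) (a : R) : Prop :=
  exists V : point,
    E V /\ parallel_to (midpt F G) V F G /\ edist (midpt F G) V = a.

Definition semi_minor_axis (E : point -> Prop) (F G : point) (b : R) : Prop :=
  exists W : point,
    E W /\ orthogonal_to (midpt F G) W F G /\ edist (midpt F G) W = b.

(* Equal abscissas mean that the major axis is parallel to the y axis; then
   "rightmost" is read as "uppermost". *)
Definition rightmost (F G : point) : Prop :=
  fst F < fst G \/ (fst F = fst G /\ snd F < snd G).

(* Main.v *)
(* Put (p, q) = F2 - center and let 2 alpha be the sum of the focal distances.
   Eliminating the square roots, E0 is the set of center + (u, v) with
     (alpha^2 - p^2) u^2 - 2 p q u v + (alpha^2 - q^2) v^2
       = alpha^2 (alpha^2 - p^2 - q^2),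
   and the right-hand side is a^2 b^2. Two quadratic forms with the same level
   set at a positive level are equal if one of them is positive definite, so
   A = alpha^2 - p^2, B = - 2 p q and C = alpha^2 - q^2. Hence r = p^2 + q^2,
   the two radicands are p^2 and q^2, and the sign of B and the choice of F2
   determine the signs of p and q. *)

Require Import Defs.
From Stdlib Require Import Reals Lra.
From Coquelicot Require Import Coquelicot.
Open Scope R_scope.

Lemma edist_sqrt (x y x' y' : R) :
  edist (x, y) (x', y') = sqrt ((x - x') ^ 2 + (y - y') ^ 2).
Proof. unfold edist, dist_euc, Rsqr; simpl; f_equal; ring. Qed.

(** Squaring one focal distance, written as [2 * alpha] minus the other, makes it affine in
    [w = p * u + q * v]; one more squaring gives the quadratic equation. Conversely, that equation
    turns both radicands into squares of [alpha + w / alpha] and [alpha - w / alpha], whose sum is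
    [2 * alpha] once both are known to be nonnegative. *)
Lemma bifocal_equation (p q alpha u v : R) :
  0 < alpha -> p ^ 2 + q ^ 2 < alpha ^ 2 ->
  sqrt ((u + p) ^ 2 + (v + q) ^ 2) + sqrt ((u - p) ^ 2 + (v - q) ^ 2)
    = 2 * alpha <->
  alpha ^ 2 * (u ^ 2 + v ^ 2) - (p * u + q * v) ^ 2
    = alpha ^ 2 * (alpha ^ 2 - (p ^ 2 + q ^ 2)).
Proof.
intros Hal Hc.
set (w := p * u + q * v).
split.
- set (d1 := sqrt ((u + p) ^ 2 + (v + q) ^ 2)).
  set (d2 := sqrt ((u - p) ^ 2 + (v - q) ^ 2)).
  intro Hs.
  assert (H1 : d1 ^ 2 = (u + p) ^ 2 + (v + q) ^ 2)
    by (apply pow2_sqrt; apply Rplus_le_le_0_compat; apply pow2_ge_0).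
  assert (H2 : d2 ^ 2 = (u - p) ^ 2 + (v - q) ^ 2)
    by (apply pow2_sqrt; apply Rplus_le_le_0_compat; apply pow2_ge_0).
  (* The quadratic terms cancel in [d1 ^ 2 - d2 ^ 2 = 4 * w]. *)
  assert (Hw : alpha * d1 = alpha ^ 2 + w).
  { replace d2 with (2 * alpha - d1) in H2 by lra. unfold w. lra. }
  assert (H3 : alpha ^ 2 * ((u + p) ^ 2 + (v + q) ^ 2) = (alpha ^ 2 + w) ^ 2)
    by (rewrite <- Hw, <- H1; ring).
  unfold w in *. lra.
- intro He.
  assert (Hcs : w ^ 2 <= (p ^ 2 + q ^ 2) * (u ^ 2 + v ^ 2)).
  { assert (0 <= (p * v - q * u) ^ 2) by apply pow2_ge_0. unfold w. lra. }
  set (c2 := p ^ 2 + q ^ 2) in *.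
  set (rho2 := u ^ 2 + v ^ 2) in *.
  assert (Hc0 : 0 <= c2) by (unfold c2; nra).
  (* Eliminating [rho2] between [He] times [c2] and Cauchy-Schwarz times [alpha ^ 2] leaves this
     bound multiplied by [alpha ^ 2 - c2 > 0]. *)
  assert (Hw2 : w ^ 2 <= alpha ^ 2 * c2).
  { apply Rmult_le_reg_l with (alpha ^ 2 - c2); [lra|].
    assert (c2 * (alpha ^ 2 * rho2 - w ^ 2) = c2 * (alpha ^ 2 * (alpha ^ 2 - c2)))
      by (rewrite He; ring).
    assert (alpha ^ 2 * w ^ 2 <= alpha ^ 2 * (c2 * rho2))
      by (apply Rmult_le_compat_l; [apply pow2_ge_0 | exact Hcs]).
    lra. }
  assert (Hwa : Rabs w <= alpha ^ 2).
  { apply Rsqr_incr_0_var; [rewrite <- Rsqr_abs; unfold Rsqr; nra | nra]. }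
  apply Rabs_le_between in Hwa.
  (* [e = 1] and [e = -1] treat the foci at [(-p, -q)] and [(p, q)] together. *)
  assert (Hfocal : forall e, e ^ 2 = 1 ->
    sqrt ((u + e * p) ^ 2 + (v + e * q) ^ 2) = Rabs (alpha + e * w / alpha)).
  { intros e He2.
    rewrite <- sqrt_Rsqr_abs. f_equal. unfold Rsqr.
    apply Rmult_eq_reg_l with (alpha ^ 2); [|nra].
    replace (alpha ^ 2 * ((alpha + e * w / alpha) * (alpha + e * w / alpha)))
      with (alpha ^ 4 + 2 * e * w * alpha ^ 2 + e ^ 2 * w ^ 2) by (field; lra).
    replace ((u + e * p) ^ 2 + (v + e * q) ^ 2)
      with (rho2 + 2 * e * w + e ^ 2 * c2) by (unfold rho2, w, c2; ring).
    rewrite He2. lra. }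
  assert (Hpos : forall t, - alpha ^ 2 <= t -> 0 <= alpha + t / alpha).
  { intros t Ht.
    replace (alpha + t / alpha) with ((alpha ^ 2 + t) / alpha) by (field; lra).
    apply Rdiv_le_0_compat; lra. }
  replace ((u + p) ^ 2 + (v + q) ^ 2) with ((u + 1 * p) ^ 2 + (v + 1 * q) ^ 2)
    by ring.
  replace ((u - p) ^ 2 + (v - q) ^ 2)
    with ((u + - 1 * p) ^ 2 + (v + - 1 * q) ^ 2) by ring.
  rewrite !Hfocal by ring.
  rewrite !Rabs_pos_eq by (apply Hpos; lra).
  field; lra.
Qed.

(** By positivity every nonzero vector can be rescaled onto the level [K] of the primed form;
    homogeneity then carries equality of the two forms back to the vector itself. Three vectors
    determine the coefficients. *)
Lemma quadratic_form_level_set_unique (A B C A' B' C' K : R) :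
  0 < K ->
  (forall u v, (u, v) <> (0, 0) ->
     0 < A' * u ^ 2 + B' * u * v + C' * v ^ 2) ->
  (forall u v, A' * u ^ 2 + B' * u * v + C' * v ^ 2 = K ->
     A * u ^ 2 + B * u * v + C * v ^ 2 = K) ->
  A = A' /\ B = B' /\ C = C'.
Proof.
intros HK Hpos Hlevel.
assert (Heq : forall u v, (u, v) <> (0, 0) ->
  A * u ^ 2 + B * u * v + C * v ^ 2 = A' * u ^ 2 + B' * u * v + C' * v ^ 2).
{ intros u v Huv.
  specialize (Hpos u v Huv).
  set (m := A' * u ^ 2 + B' * u * v + C' * v ^ 2) in *.
  assert (Hm : 0 < K / m) by (apply Rdiv_lt_0_compat; lra).
  set (t := sqrt (K / m)).
  assert (Ht : t ^ 2 = K / m) by (apply pow2_sqrt; lra).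
  assert (H := Hlevel (t * u) (t * v)).
  replace (A' * (t * u) ^ 2 + B' * (t * u) * (t * v) + C' * (t * v) ^ 2)
    with (t ^ 2 * m) in H by (unfold m; ring).
  replace (A * (t * u) ^ 2 + B * (t * u) * (t * v) + C * (t * v) ^ 2)
    with (t ^ 2 * (A * u ^ 2 + B * u * v + C * v ^ 2)) in H by ring.
  assert (Htm : t ^ 2 * m = K) by (rewrite Ht; field; lra).
  apply Rmult_eq_reg_l with (t ^ 2); [|lra].
  rewrite Htm. exact (H Htm). }
assert (H10 := Heq 1 0 ltac:(intros [=]; lra)).
assert (H01 := Heq 0 1 ltac:(intros [=]; lra)).
assert (H11 := Heq 1 1 ltac:(intros [=]; lra)).
lra.
Qed.

Theorem theorem2 (E0 : point -> Prop) (F1 : point)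
  (x0 y0 xc yc a b A B C : R)
  (hE0 : ellipse_with_foci E0 F1 (xc, yc))
  (hnc : ~ is_circle E0)
  (hF2 : rightmost F1 (xc, yc))
  (hcenter : (x0, y0) = midpt F1 (xc, yc))
  (ha : semi_major_axis E0 F1 (xc, yc) a)
  (hb : semi_minor_axis E0 F1 (xc, yc) b)
  (hA : 0 < A) (hC : 0 < C)
  (heq : forall x y : R,
     E0 (x, y) <->
     A * (x - x0) ^ 2 + B * (x - x0) * (y - y0) + C * (y - y0) ^ 2
       - a ^ 2 * b ^ 2 = 0) :
  let r := sqrt ((A - C) ^ 2 + B ^ 2) in
  (B <> 0 ->
     xc = x0 + sqrt ((r + C - A) / 2) /\
     yc = y0 - sign B * sqrt ((r + A - C) / 2)) /\
  (B = 0 ->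
     xc = x0 + 1 / 2 * (1 - sign (A - C)) * sqrt ((r + C - A) / 2) /\
     yc = y0 + 1 / 2 * (1 + sign (A - C)) * sqrt ((r + A - C) / 2)).
Proof.
intro r.
destruct F1 as [x1 y1].
unfold midpt in hcenter; simpl in hcenter.
injection hcenter as hx hy.
set (p := xc - x0).
set (q := yc - y0).
assert (hx1 : x1 = x0 - p) by (unfold p; lra).
assert (hy1 : y1 = y0 - q) by (unfold q; lra).
assert (hxc : xc = x0 + p) by (unfold p; lra).
assert (hyc : yc = y0 + q) by (unfold q; lra).
clearbody p q.
clear hx hy.
subst x1 y1 xc yc.
assert (Hmid : midpt (x0 - p, y0 - q) (x0 + p, y0 + q) = (x0, y0))
  by (unfold midpt; simpl; f_equal; field).
assert (Hpq : 0 < p \/ p = 0 /\ 0 < q)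
  by (unfold rightmost in hF2; simpl in hF2; lra).
assert (Hpq0 : 0 < p ^ 2 + q ^ 2) by (destruct Hpq as [|[-> ]]; nra).
destruct hE0 as [s [Hs HE]].
set (alpha := s / 2).
assert (Hfoc : sqrt (p ^ 2 + q ^ 2) < alpha).
{ rewrite edist_sqrt in Hs.
  replace ((x0 - p - (x0 + p)) ^ 2 + (y0 - q - (y0 + q)) ^ 2)
    with (2 ^ 2 * (p ^ 2 + q ^ 2)) in Hs by ring.
  rewrite sqrt_mult, sqrt_pow2 in Hs by lra.
  unfold alpha; lra. }
assert (Hsq := sqrt_pos (p ^ 2 + q ^ 2)).
assert (Hal : 0 < alpha) by lra.
assert (Hc : p ^ 2 + q ^ 2 < alpha ^ 2)
  by (rewrite <- (pow2_sqrt (p ^ 2 + q ^ 2)) by lra; nra).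
assert (Heq : forall u v, E0 (x0 + u, y0 + v) <->
  alpha ^ 2 * (u ^ 2 + v ^ 2) - (p * u + q * v) ^ 2
    = alpha ^ 2 * (alpha ^ 2 - (p ^ 2 + q ^ 2))).
{ intros u v.
  rewrite <- (bifocal_equation p q alpha u v Hal Hc), HE, !edist_sqrt.
  replace (x0 + u - (x0 - p)) with (u + p) by ring.
  replace (y0 + v - (y0 - q)) with (v + q) by ring.
  replace (x0 + u - (x0 + p)) with (u - p) by ring.
  replace (y0 + v - (y0 + q)) with (v - q) by ring.
  replace (2 * alpha) with s by (unfold alpha; field).
  reflexivity. }
assert (Hvec : forall P d, E0 P -> edist (x0, y0) P = d ->
  exists u v, P = (x0 + u, y0 + v) /\ d ^ 2 = u ^ 2 + v ^ 2 /\
    alpha ^ 2 * (u ^ 2 + v ^ 2) - (p * u + q * v) ^ 2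
      = alpha ^ 2 * (alpha ^ 2 - (p ^ 2 + q ^ 2))).
{ intros [x y] d HP Hd.
  exists (x - x0), (y - y0).
  assert (Hxy : (x, y) = (x0 + (x - x0), y0 + (y - y0))) by (f_equal; ring).
  split; [exact Hxy|].
  split; [|apply Heq; rewrite <- Hxy; exact HP].
  rewrite <- Hd, edist_sqrt, pow2_sqrt; [ring|].
  apply Rplus_le_le_0_compat; apply pow2_ge_0. }
assert (Ha : a ^ 2 = alpha ^ 2).
{ destruct ha as [V [HV [Hpar Hd]]].
  unfold parallel_to in Hpar.
  rewrite Hmid in Hpar, Hd.
  destruct (Hvec V a HV Hd) as (u & v & -> & -> & He).
  simpl in Hpar.
  assert (Huv : p * v - q * u = 0) by lra.
  apply Rmult_eq_reg_l with (alpha ^ 2 - (p ^ 2 + q ^ 2)); [|lra].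
  (* By Lagrange's identity, [(p * u + q * v) ^ 2] is now [(p ^ 2 + q ^ 2) * (u ^ 2 + v ^ 2)], so
     [He] acquires the factor to be cancelled. *)
  assert ((p * v - q * u) ^ 2 = 0) by (rewrite Huv; ring).
  lra. }
assert (Hb : b ^ 2 = alpha ^ 2 - (p ^ 2 + q ^ 2)).
{ destruct hb as [W [HW [Hort Hd]]].
  unfold orthogonal_to in Hort.
  rewrite Hmid in Hort, Hd.
  destruct (Hvec W b HW Hd) as (u & v & -> & -> & He).
  simpl in Hort.
  assert (Huv : p * u + q * v = 0) by lra.
  apply Rmult_eq_reg_l with (alpha ^ 2); [|lra].
  rewrite Huv in He. lra. }
destruct (quadratic_form_level_set_unique A B C
  (alpha ^ 2 - p ^ 2) (- 2 * p * q) (alpha ^ 2 - q ^ 2)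
  (alpha ^ 2 * (alpha ^ 2 - (p ^ 2 + q ^ 2)))) as (HA & HB & HC).
- apply Rmult_lt_0_compat; lra.
- intros u v Huv.
  assert (Huv0 : 0 < u ^ 2 + v ^ 2).
  { destruct (Req_dec u 0) as [->|]; [|nra].
    destruct (Req_dec v 0) as [->|]; [now elim Huv|nra]. }
  (* The form equals [(alpha ^ 2 - (p ^ 2 + q ^ 2)) * (u ^ 2 + v ^ 2) + (p * v - q * u) ^ 2]. *)
  assert (0 <= (p * v - q * u) ^ 2) by apply pow2_ge_0.
  assert (0 < (alpha ^ 2 - (p ^ 2 + q ^ 2)) * (u ^ 2 + v ^ 2))
    by (apply Rmult_lt_0_compat; lra).
  lra.
- intros u v Hlev.
  assert (HEuv : E0 (x0 + u, y0 + v)) by (apply Heq; lra).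
  apply heq in HEuv.
  rewrite Ha, Hb in HEuv.
  replace (x0 + u - x0) with u in HEuv by ring.
  replace (y0 + v - y0) with v in HEuv by ring.
  lra.
- assert (Hr : r = p ^ 2 + q ^ 2).
  { unfold r.
    replace ((A - C) ^ 2 + B ^ 2) with ((p ^ 2 + q ^ 2) ^ 2)
      by (rewrite HA, HB, HC; ring).
    apply sqrt_pow2; lra. }
  assert (Hx : sqrt ((r + C - A) / 2) = p).
  { replace ((r + C - A) / 2) with (p ^ 2) by (rewrite Hr, HA, HC; field).
    apply sqrt_pow2; lra. }
  assert (Hy : sqrt ((r + A - C) / 2) = Rabs q).
  { replace ((r + A - C) / 2) with (Rsqr q)
      by (rewrite Hr, HA, HC; unfold Rsqr; field).
    apply sqrt_Rsqr_abs. }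
  rewrite Hx, Hy.
  split; intro HB0.
  + assert (Hp : 0 < p) by (destruct Hpq as [|[-> ]]; [assumption|lra]).
    split; [reflexivity|].
    (* As [B = - 2 * p * q] with [p > 0], the sign of [B] is opposite to that of [q]. *)
    destruct (Rtotal_order q 0) as [Hq|[->|Hq]]; [|lra|].
    * rewrite sign_eq_1, Rabs_left by nra. ring.
    * rewrite sign_eq_m1, Rabs_pos_eq by nra. ring.
  (* Here [p * q = 0] and [A - C = q ^ 2 - p ^ 2]: the sign is -1 for a horizontal major axis and 1
     for a vertical one, so the halved factors select the nonzero coordinate. *)
  + destruct Hpq as [Hp|[-> Hq]].
    * assert (Hq : q = 0) by nra.
      subst q.
      rewrite sign_eq_m1, Rabs_R0 by nra. lra.
    * rewrite sign_eq_1, Rabs_pos_eq by nra. lra.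
Qed.
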